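(* Let $Q,T_1,T_2\in\mathcal{B}(\mathcal{H})$ be any contractions such that $T_1T_2=T_2QT_1$. Then there is a Hilbert space $\mathcal{K}$ containing $\mathcal{H}$, an isometric lift $\overline{Q}\in\mathcal{B}(\mathcal{K})$ of $Q$, and isometric lifts $V_1,V_2\in\mathcal{B}(\mathcal{K})$ of $T_1,T_2$ respectively, such that $V_1V_2=V_2\overline{Q}V_1$. Moreover, if $Q$ is an isometry, then $\overline{Q}$ can be chosen to be $Q\oplus qI$ with respect to the decomposition $\mathcal{K}=\mathcal{H}\oplus(\mathcal{K}\ominus\mathcal{H})$, for any complex number $q$ of modulus one.
   Context: All Hilbert spaces are complex; $\mathcal{B}(\mathcal{H})$ is the algebra of bounded linear operators on $\mathcal{H}$; containment of Hilbert spaces means containment as a closed linear subspace; a contraction is an operator of norm at most one. An operator $B\in\mathcal{B}(\mathcal{K})$ is a lift of $A\in\mathcal{B}(\mathcal{H})$, $\mathcal{H}\subseteq\mathcal{K}$, if $\mathcal{H}$ is invariant under $B^*$ and $B^*|_{\mathcal{H}}=A^*$; it is an isometric lift if in addition $B$ is an isometry. *)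

(* Defs.v *)
From HB Require Import structures.
From mathcomp Require Import all_boot all_order all_algebra.
From mathcomp Require Import all_classical all_reals all_analysis.
From mathcomp Require Import complex.

Set Implicit Arguments.
Unset Strict Implicit.
Unset Printing Implicit Defensive.

Import Order.TTheory GRing.Theory Num.Theory.
Import numFieldNormedType.Exports.

Local Open Scope classical_set_scope.
Local Open Scope ring_scope.
Local Open Scope complex_scope.

(* The inner product is linear in its first argument and conjugate-linear in
   its second one. *)
HB.mixin Record isHilbert (R : realType) H
    of CompleteNormedModule R[i] H := {
  inner : {dot H for (Num.conj : R[i] -> R[i])} ;
  sqr_norm_inner : forall x : H, `|x| ^+ 2 = inner x x
}.

#[short(type="hilbertType")]
HB.structure Definition Hilbert (R : realType) :=
  {H of isHilbert R H & CompleteNormedModule R[i] H}.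

Record bounded_op (R : realType) (H K : hilbertType R) := BoundedOp {
  linear_of_bounded_op :> {linear H -> K} ;
  bounded_opP : bounded_near linear_of_bounded_op (nbhs (0 : H))
}.

Notation "''B' ( H , K )" := (bounded_op H K)
  (at level 8, format "''B' ( H ,  K )") : type_scope.
Notation "''B' ( H )" := (bounded_op H H)
  (at level 8, format "''B' ( H )") : type_scope.

Section Operators.
Variable R : realType.
Implicit Types H K : hilbertType R.

(* The norm of a [normedModType R[i]] takes its (real) values in [R[i]], hence
   the real part. *)
Definition opnorm H K (A : 'B(H, K)) : R :=
  sup [set complex.Re `|A x| | x in [set x : H | `|x| <= 1]].

Definition contraction_op H K (A : 'B(H, K)) : Prop := opnorm A <= 1.

Lemma contraction_opP H K (A : 'B(H, K)) :
  contraction_op A <-> forall x, `|A x| <= `|x|.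
Proof.
have ReK (W : hilbertType R) (w : W) : (complex.Re `|w|)%:C = `|w|.
  by rewrite RRe_real // normr_real.
set S := [set complex.Re `|A x| | x in [set x : H | `|x| <= 1]].
have S0 : S !=set0.
  by exists (complex.Re `|A 0|), 0 => //=; rewrite normr0 ler01.
split => [A1 x|A1]; last first.
  apply: (ge_sup S0) => _ [x /= x1 <-].
  rewrite -(lecR _ 1) ReK (le_trans (A1 x)) //.
have ubS : has_ubound S.
  have /linear_boundedP := @bounded_opP _ _ _ A.
  case/pinfty_ex_gt0 => M M0 AM.
  exists (complex.Re M) => _ [y /= y1 <-].
  rewrite -lecR ReK RRe_real ?gtr0_real //.
  by rewrite (le_trans (AM y)) // ler_piMr // ltW.
have [->|x0] := eqVneq x 0; first by rewrite linear0 normr0.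
have nx0 : 0 < `|x| by rewrite normr_gt0.
have : complex.Re `|A (`|x|^-1 *: x)| <= 1.
  apply: le_trans A1; apply: (ub_le_sup ubS).
  exists (`|x|^-1 *: x) => //=.
  by rewrite normrZ normfV normr_id mulVf ?gt_eqF.
rewrite -(lecR _ 1) ReK linearZ normrZ normfV normr_id.
by rewrite ler_pdivrMl // mulr1.
Qed.

Definition isometry_op H K (A : 'B(H, K)) : Prop := forall x, `|A x| = `|x|.

Definition is_adjoint H K (A : 'B(H, K)) (A' : 'B(K, H)) : Prop :=
  forall x y, inner (A x) y = inner x (A' y).

Lemma is_adjoint_uniq H K (A : 'B(H, K)) (A1 A2 : 'B(K, H)) :
  is_adjoint A A1 -> is_adjoint A A2 -> A1 =1 A2.
Proof.
move=> adj1 adj2 y; apply/eqP; rewrite -subr_eq0 -normr_eq0 -sqrf_eq0.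
by rewrite sqr_norm_inner linearB /= -adj1 -adj2 subrr.
Qed.

(* [H] is regarded as a closed subspace of [K] through an isometric embedding
   [iota]. The equation says both that the range of [iota] is invariant under
   the adjoint of [B] and that this adjoint restricts to the adjoint of [A]. *)
Definition is_lift H K (iota : 'B(H, K)) (A : 'B(H)) (B : 'B(K)) : Prop :=
  exists (A' : 'B(H)) (B' : 'B(K)),
    [/\ is_adjoint A A', is_adjoint B B' &
        forall x, B' (iota x) = iota (A' x)].

Definition is_isometric_lift H K (iota : 'B(H, K)) (A : 'B(H)) (B : 'B(K)) :
    Prop :=
  is_lift iota A B /\ isometry_op B.

Definition orthocompl H K (iota : 'B(H, K)) : set K :=
  [set y | forall x, inner (iota x) y = 0].

(* [B] is the direct sum of [A] and [q] times the identity, for the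
   decomposition of [K] as [H] plus its orthogonal complement. *)
Definition dsum_scalar H K (iota : 'B(H, K)) (A : 'B(H)) (q : R[i])
    (B : 'B(K)) : Prop :=
  forall x y, orthocompl iota y -> B (iota x + y) = iota (A x) + q *: y.

End Operators.

(* Main.v *)
Require Import Defs.
From HB Require Import structures.
From mathcomp Require Import all_boot all_order all_algebra.
From mathcomp Require Import all_classical all_reals all_analysis.
From mathcomp Require Import complex.
From mathcomp Require Import ring lra.

Set Implicit Arguments.
Unset Strict Implicit.
Unset Printing Implicit Defensive.

Import Order.TTheory GRing.Theory Num.Theory.
Import numFieldNormedType.Exports.

Local Open Scope ring_scope.
Local Open Scope complex_scope.

(** Assume first that Q is an isometry.  On K = H + F + F + ..., where the
    Hilbert space F carries the two off-diagonal matrix units alpha and beta of a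
    splitting F = F0 + F1 (alpha maps F0 onto F1, beta maps F1 onto F0), put

      W_i (h, x_1, x_2, ...) =
        (T_i h, j_i h + alpha x_1, beta x_1 + alpha x_2, beta x_2 + alpha x_3, ...)

    where j_i : H -> F0 satisfies |j_i h|^2 = |h|^2 - |T_i h|^2 and the ranges of
    j_1 and j_2 are orthogonal.  The shift by half a block that maps x to
    (alpha x_1, beta x_1 + alpha x_2, ...) is isometric and its square is the
    unilateral shift.  Hence W_i is an isometric lift of T_i, and with
    Qbar = Q + q on H and its complement,

      W_1 W_2 (h, x)      = (T_1 T_2 h,   p h, x_1,   x_2,   ...),
      W_2 Qbar W_1 (h, x) = (T_2 Q T_1 h, r h, q x_1, q x_2, ...),
      p = j_1 T_2 + alpha j_2,   r = j_2 Q T_1 + q alpha j_1.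

    The first coordinates agree by hypothesis.  Since Q is isometric, both |p h|^2
    and |r h|^2 equal |h|^2 minus the squared norm of that coordinate, and the
    ranges of p and r are orthogonal.  Therefore the reflection S of F that fixes
    the vectors orthogonal to all p h - r h exchanges p h and r h.  The unitary
    G = 1 + S + q S + q^2 S + ... on K commutes with Qbar and satisfies
    G W_1 W_2 = W_2 Qbar W_1 G, so that V_1 = G W_1 and V_2 = W_2 G^-1 are
    isometric lifts of T_1 and T_2 with V_1 V_2 = V_2 Qbar V_1.  This is Ando's
    construction of commuting isometric dilations, with the unitary twisted by q.

    For a contraction Q, take an isometric lift Q' of Q on some H' containing H
    and extend T_1 and T_2 by zero on the complement of H.  The extensions only
    see the compression of Q' to H, which is Q; so the relation persists, and the
    case q = 1 of the first step, applied on H', gives lifts of lifts.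

    The maps j_i replace the square roots of 1 - T_i^* T_i: starting from
    B_0 = 1 - T^* T, the recursion B_{n+1} = B_n - B_n^2 splits <B_0 h, h> into
    the sum of the |B_n h|^2 ([ex_sqrt_series]), so the sequence (B_n h) is an
    element of a countable sum of copies of H with the required norm.  All the
    isometries above are block operators of one shape ([ex_bidiagonal]); they
    are lifts because their first coordinate depends on the first coordinate only
    ([lift_criterion]).  Adjoints and the reflection come from a single
    variational argument on closed subspaces ([riesz_on]). *)

(** * Real parts of inner products *)

Section DotForm.
Variables (R : realType) (U : lmodType R[i]).
Variable f : {dot U for (Num.conj : R[i] -> R[i])}.
Implicit Types x y z : U.

(** The real part determines the form, see [dotE]; it keeps all estimates inside
    the totally ordered field [R]. *)
Definition rdot x y : R := complex.Re (f x y).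
Definition sqn x : R := rdot x x.

Lemma rdotDl x y z : rdot (x + y) z = rdot x z + rdot y z.
Proof. by rewrite /rdot linearDl /=; case: (f x z) (f y z) => [? ?] []. Qed.

Lemma dotC x y : f x y = (f y x)^*.
Proof. by rewrite hermC expr0 mul1r. Qed.

Lemma rdotC x y : rdot x y = rdot y x.
Proof. by rewrite /rdot dotC; case: (f y x). Qed.

Lemma rdotDr x y z : rdot x (y + z) = rdot x y + rdot x z.
Proof. by rewrite rdotC rdotDl !(rdotC x). Qed.

Lemma rdotZl (a : R) x y : rdot (a%:C *: x) y = a * rdot x y.
Proof.
by rewrite /rdot linearZl_LR /=; case: (f x y) => u v /=; rewrite mul0r subr0.
Qed.

Lemma rdotZr (a : R) x y : rdot x (a%:C *: y) = a * rdot x y.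
Proof. by rewrite rdotC rdotZl rdotC. Qed.

Lemma rdotNl x y : rdot (- x) y = - rdot x y.
Proof. by rewrite /rdot linearNl /=; case: (f x y). Qed.

Lemma rdotNr x y : rdot x (- y) = - rdot x y.
Proof. by rewrite rdotC rdotNl rdotC. Qed.

Lemma rdotBl x y z : rdot (x - y) z = rdot x z - rdot y z.
Proof. by rewrite rdotDl rdotNl. Qed.

Lemma rdotBr x y z : rdot x (y - z) = rdot x y - rdot x z.
Proof. by rewrite rdotDr rdotNr. Qed.

Lemma rdot0l x : rdot 0 x = 0.
Proof. by rewrite -(subrr x) rdotBl subrr. Qed.

Lemma rdot0r x : rdot x 0 = 0.
Proof. by rewrite rdotC rdot0l. Qed.

Lemma Im_dot x y : complex.Im (f x y) = rdot x ('i%C *: y).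
Proof.
rewrite /rdot linearZr_LR /=; case: (f x y) => u v /=.
by rewrite !mul0r mulN1r sub0r opprK.
Qed.

Lemma rdotiC x y : rdot ('i%C *: x) y = - rdot x ('i%C *: y).
Proof.
by rewrite -Im_dot /rdot linearZl_LR /=; case: (f x y) => u v /=; rewrite mul0r mul1r sub0r.
Qed.

Lemma dotE x y : f x y = rdot x y +i* rdot x ('i%C *: y).
Proof. by rewrite -Im_dot /rdot; case: (f x y). Qed.

Lemma sqnE x : f x x = (sqn x)%:C.
Proof.
have /complex_realP[k E] : f x x \is Num.real by apply: ger0_real; rewrite dnorm_ge0.
by rewrite /sqn /rdot E.
Qed.

Lemma sqn_ge0 x : 0 <= sqn x.
Proof. by rewrite -lecR -sqnE dnorm_ge0. Qed.

Lemma sqn_eq0 x : sqn x = 0 -> x = 0.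
Proof. by move=> x0; apply/eqP; rewrite -(dnorm_eq0 f) sqnE x0. Qed.

Lemma sqn0 : sqn 0 = 0.
Proof. exact: rdot0l. Qed.

Lemma sqnD x y : sqn (x + y) = sqn x + sqn y + 2 * rdot x y.
Proof. by rewrite /sqn !rdotDl !rdotDr (rdotC y x); ring. Qed.

Lemma sqnN x : sqn (- x) = sqn x.
Proof. by rewrite /sqn rdotNl rdotNr opprK. Qed.

Lemma sqnB x y : sqn (x - y) = sqn x + sqn y - 2 * rdot x y.
Proof. by rewrite sqnD sqnN rdotNr; ring. Qed.

Lemma sqnBC x y : sqn (x - y) = sqn (y - x).
Proof. by rewrite -sqnN opprB. Qed.

Lemma sqnZ (a : R[i]) x : sqn (a *: x) = Normc.normc a ^+ 2 * sqn x.
Proof.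
rewrite /sqn /rdot dnormZ sqnE; case: a => a b.
by rewrite normc_def -rmorphXn -rmorphM.
Qed.

Lemma sqnZr (a : R) x : sqn (a%:C *: x) = a ^+ 2 * sqn x.
Proof. by rewrite /sqn rdotZl rdotZr mulrA. Qed.

Lemma parallelogram x y : sqn (x + y) + sqn (x - y) = 2 * sqn x + 2 * sqn y.
Proof. by rewrite sqnD sqnB; ring. Qed.

Lemma sqnD_le x y : sqn (x + y) <= 2 * sqn x + 2 * sqn y.
Proof. by rewrite -parallelogram lerDl sqn_ge0. Qed.

Lemma cauchy_schwarz x y : rdot x y ^+ 2 <= sqn x * sqn y.
Proof.
have [y0|y0] := eqVneq (sqn y) 0.
  by rewrite (sqn_eq0 y0) rdot0r sqn0 mulr0 expr0n.
have yp : 0 < sqn y by rewrite lt_def y0 sqn_ge0.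
have := sqn_ge0 ((sqn y)%:C *: x - (rdot x y)%:C *: y).
rewrite sqnB !sqnZr rdotZl rdotZr.
rewrite (_ : _ - _ = sqn y * (sqn x * sqn y - rdot x y ^+ 2)); last by ring.
by rewrite pmulr_rge0 // subr_ge0.
Qed.

Definition hnrm x : R := Num.sqrt (sqn x).

Lemma hnrm_sqr x : hnrm x ^+ 2 = sqn x.
Proof. by rewrite sqr_sqrtr // sqn_ge0. Qed.

Lemma hnrm_ge0 x : 0 <= hnrm x. Proof. exact: sqrtr_ge0. Qed.

Lemma rdot_le_hnrm x y : `|rdot x y| <= hnrm x * hnrm y.
Proof.
by rewrite /hnrm -sqrtrM ?sqn_ge0 // -sqrtr_sqr ler_wsqrtr // cauchy_schwarz.
Qed.

Lemma hnrmD x y : hnrm (x + y) <= hnrm x + hnrm y.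
Proof.
rewrite -(@ler_pXn2r _ 2) ?nnegrE ?addr_ge0 ?hnrm_ge0 //.
rewrite sqrrD !hnrm_sqr sqnD.
have := rdot_le_hnrm x y; have := ler_norm (rdot x y); lra.
Qed.

Lemma hnrmZ (a : R[i]) x : hnrm (a *: x) = Normc.normc a * hnrm x.
Proof.
have a0 : 0 <= Normc.normc a by case: a => a b; exact: sqrtr_ge0.
by rewrite /hnrm sqnZ sqrtrM ?exprn_ge0 // sqrtr_sqr ger0_norm.
Qed.

End DotForm.

Lemma scale_ReIm (R : realType) (V : lmodType R[i]) (a : R[i]) (x : V) :
  a *: x = (complex.Re a)%:C *: x + (complex.Im a)%:C *: ('i%C *: x).
Proof.
by rewrite scalerA -scalerDl [LHS](congr1 (fun b => b *: x) (complexE a)) (mulrC 'i%C).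
Qed.

Lemma natSinv_small (R : realType) (e : R) : 0 < e ->
  exists N : nat, forall n, (N <= n)%N -> (n.+1%:R^-1 : R) <= e.
Proof.
move=> e0; have [N _ HN] := near_infty_natSinv_lt (PosNum e0).
by exists N => n /HN /ltW.
Qed.

Local Notation rin := (rdot inner).
Local Notation nsq := (sqn inner).

(** * Completeness and bounded operators in terms of squared norms *)

Section HilbertBasics.
Local Open Scope classical_set_scope.
Variable R : realType.
Implicit Types H K : hilbertType R.

Lemma norm_hnrm H (x : H) : `|x| = (hnrm inner x)%:C.
Proof.
apply/eqP; rewrite -(@eqrXn2 _ 2) ?lecR ?hnrm_ge0 //.
by rewrite sqr_norm_inner sqnE -hnrm_sqr rmorphXn.
Qed.

Lemma norm_le_nsq H K (x : H) (y : K) : (`|x| <= `|y|) = (nsq x <= nsq y).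
Proof.
by rewrite !norm_hnrm lecR -!hnrm_sqr ler_pXn2r ?nnegrE ?hnrm_ge0.
Qed.

Lemma norm_eq_nsq H K (x : H) (y : K) : `|x| = `|y| <-> nsq x = nsq y.
Proof.
rewrite !norm_hnrm -!hnrm_sqr; split=> [/complexI ->//|/eqP].
by rewrite eqrXn2 ?hnrm_ge0 // => /eqP ->.
Qed.

Lemma norm_lt_nsq H (x : H) (e : R) : 0 < e -> (`|x| < e%:C) = (nsq x < e ^+ 2).
Proof.
by move=> e0; rewrite norm_hnrm ltcR -hnrm_sqr ltr_pXn2r ?nnegrE ?hnrm_ge0 // ltW.
Qed.

Lemma gt0_complexP (e : R[i]) : 0 < e -> exists2 r : R, 0 < r & e = r%:C.
Proof.
move=> e0; have /complex_realP[r E] : e \is Num.real by exact: gtr0_real.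
by exists r => //; rewrite -ltcR -E.
Qed.

Lemma rin_inj H (y z : H) : (forall x, rin x y = rin x z) -> y = z.
Proof.
move=> E; apply/eqP; rewrite -subr_eq0; apply/eqP/(@sqn_eq0 _ _ inner).
by rewrite /sqn rdotBr E subrr.
Qed.

Definition seq_to H (u : nat -> H) (l : H) : Prop :=
  forall e : R, 0 < e -> exists N, forall n, (N <= n)%N -> nsq (u n - l) <= e.

Lemma hilbert_complete H (u : nat -> H) :
  (forall e : R, 0 < e -> exists N, forall m n, (N <= m)%N -> (N <= n)%N ->
     nsq (u m - u n) <= e) ->
  exists l, seq_to u l.
Proof.
move=> cu.
have /cauchy_cvg ul : cauchy (u @ \oo).
  apply: cauchy_exP => _/gt0_complexP[e e0 ->].
  have e20 : 0 < e ^+ 2 / 2 by rewrite divr_gt0 ?exprn_gt0.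
  have [N uN] := cu _ e20.
  exists (u N); exists N => // n /= Nn.
  rewrite -ball_normE /= norm_lt_nsq // (le_lt_trans (uN _ _ _ Nn)) //.
  by rewrite ltr_pdivrMr // mulr_natr mulr2n ltrDl exprn_gt0.
exists (lim (u @ \oo)) => e e0.
move/cvgrPdist_lt : ul => /(_ (Num.sqrt e)%:C).
rewrite ltcR sqrtr_gt0 => /(_ e0) [N _ uN]; exists N => n Nn.
have := uN n Nn; rewrite /= norm_lt_nsq ?sqrtr_gt0 // sqr_sqrtr ?(ltW e0) //.
by rewrite (sqnBC _ (u n)) => /ltW.
Qed.

Definition mk_bounded H K (f : {linear H -> K}) (M : R)
  (fM : forall x, nsq (f x) <= M * nsq x) : 'B(H, K).
Proof.
exists f; apply/linear_boundedP.
exists (Num.sqrt M)%:C; split; first by rewrite complex_real.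
move=> r Mr x.
have r0 : 0 < r by rewrite (le_lt_trans _ Mr) // ler0c sqrtr_ge0.
have [s s0 rE] := gt0_complexP r0.
move: Mr; rewrite rE ltcR => Ms.
rewrite !norm_hnrm -rmorphM lecR -(@ler_pXn2r _ 2) ?nnegrE ?mulr_ge0 ?hnrm_ge0 //; last exact: ltW.
rewrite exprMn !hnrm_sqr (le_trans (fM x)) // ler_wpM2r ?sqn_ge0 //.
have [M0|M0] := ltP M 0; first by rewrite (le_trans (ltW M0)) ?exprn_ge0 ?(ltW s0).
by rewrite -(sqr_sqrtr M0) ler_pXn2r ?nnegrE ?sqrtr_ge0 ?(ltW s0) ?(ltW Ms).
Defined.

Lemma bounded_nsq H K (A : 'B(H, K)) :
  exists2 M : R, 0 < M & forall x, nsq (A x) <= M * nsq x.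
Proof.
have /linear_boundedP := @bounded_opP _ _ _ A.
case/pinfty_ex_gt0 => _ /gt0_complexP[M M0 ->] AM; exists (M ^+ 2); first exact: exprn_gt0.
move=> x; have := AM x; rewrite !norm_hnrm -rmorphM lecR => h.
rewrite -!hnrm_sqr -exprMn ler_pXn2r ?nnegrE ?mulr_ge0 ?hnrm_ge0 //.
exact: ltW.
Qed.

Lemma contraction_nsq H K (A : 'B(H, K)) :
  contraction_op A <-> forall x, nsq (A x) <= nsq x.
Proof.
by rewrite contraction_opP; split=> h x; have := h x; rewrite norm_le_nsq.
Qed.

Lemma isometry_nsq H K (A : 'B(H, K)) :
  isometry_op A <-> forall x, nsq (A x) = nsq x.
Proof. by split=> h x; apply/norm_eq_nsq/h. Qed.

Lemma adjoint_rin H K (A : 'B(H, K)) (A' : 'B(K, H)) :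
  (forall x y, rin (A x) y = rin x (A' y)) -> is_adjoint A A'.
Proof. by move=> h x y; rewrite !dotE -[_ *: A' y]linearZ -!h. Qed.

Lemma rin_adjoint H K (A : 'B(H, K)) (A' : 'B(K, H)) :
  is_adjoint A A' -> forall x y, rin (A x) y = rin x (A' y).
Proof. by move=> h x y; rewrite /rdot h. Qed.

Lemma discr_le (e c s : R) : 0 < e -> 0 <= s ->
  (forall t, 0 <= e + 2 * (t * c) + t ^+ 2 * s) -> c ^+ 2 <= e * s.
Proof.
move=> e0; rewrite le_eqVlt => /orP[/eqP <- h|s0 h].
  have [->|c0] := eqVneq c 0; first by rewrite expr0n mulr0.
  have := h (- e / c); rewrite mulr0 addr0 divfK //; lra.
have := h (- c / s).
rewrite (_ : _ + _ = (e * s - c ^+ 2) / s); last by field; rewrite gt_eqF.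
by rewrite pmulr_lge0 ?invr_gt0 // subr_ge0.
Qed.

(** The representing vector minimises |z|^2 - 2 phi z over M.  The parallelogram
    identity makes minimising sequences Cauchy, and the first-order condition at
    the limit is the representation.  With M = H this represents functionals;
    with phi = <., x> it yields the orthogonal projection of x on M. *)
Lemma riesz_on H (M : H -> Prop) (phi : H -> R) (C : R) :
  M 0 -> (forall (a : R) x y, M x -> M y -> M (x + a%:C *: y)) ->
  (forall u l, (forall n, M (u n)) -> seq_to u l -> M l) ->
  (forall (a : R) x y, phi (x + a%:C *: y) = phi x + a * phi y) ->
  0 <= C -> (forall x, phi x ^+ 2 <= C * nsq x) ->
  exists2 z, M z & forall x, M x -> phi x = rin x z.
Proof.
move=> M0 ML Mcl phiL C0 phiC.
(* J z is the squared distance to the representing vector, up to a constant. *)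
pose J z := nsq z - 2 * phi z.
have Jbd z : - C <= J z.
  rewrite leNgt; apply/negP; rewrite /J => h.
  have n0 := sqn_ge0 inner z.
  have : (nsq z + C) ^+ 2 < (2 * phi z) ^+ 2.
    by rewrite ltr_pXn2r // ?nnegrE; lra.
  have := phiC z; have := sqr_ge0 (nsq z - C).
  rewrite sqrrB sqrrD exprMn; lra.
pose S := [set J z | z in M].
have S0 : S !=set0 by exists (J 0), 0.
have Slb : has_lbound S by exists (- C) => _ [z _ <-].
pose d := inf S.
have dJ z : M z -> d <= J z by move=> Mz; apply: ge_inf => //; exists z.
have near_min (e : R) : 0 < e -> exists2 z, M z & J z < d + e.
  move=> e0; have [|_ [z Mz <-] Jz] := @inf_adherent _ S e e0 _.
    by split.
  by exists z.
have /choice[u uP] : forall n : nat, exists z, M z /\ J z < d + n.+1%:R^-1.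
  by move=> n; have [|z Mz Jz] := near_min n.+1%:R^-1; [rewrite invr_gt0|exists z].
have Mu n : M (u n) by case: (uP n).
have Ju n : J (u n) < d + n.+1%:R^-1 by case: (uP n).
have close x y : M x -> M y -> nsq (x - y) <= 2 * (J x + J y - 2 * d).
  move=> Mx My.
  have Mm : M ((2^-1)%:C *: (x + y)).
    have := ML 2^-1 0 (x + 1%:C *: y) M0 (ML 1 _ _ Mx My).
    by rewrite add0r scale1r.
  have phiD : phi (x + y) = phi x + phi y.
    by have := phiL 1 x y; rewrite scale1r mul1r.
  have phi0 : phi 0 = 0 by have := phiL 1 0 0; rewrite scale1r mul1r addr0; lra.
  have phiZ : phi ((2^-1)%:C *: (x + y)) = 2^-1 * (phi x + phi y).
    by have := phiL 2^-1 0 (x + y); rewrite add0r phi0 add0r phiD.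
  have := dJ _ Mm; rewrite /J phiZ sqnZr.
  have := parallelogram inner x y; lra.
have [z uz] : exists z, seq_to u z.
  apply: hilbert_complete => e e0.
  have [|N HN] := @natSinv_small _ (e / 4); first by rewrite divr_gt0.
  exists N => m n /HN Hm /HN Hn.
  have := close _ _ (Mu m) (Mu n); have := Ju m; have := Ju n.
  move: (m.+1%:R^-1) (n.+1%:R^-1) (J (u m)) (J (u n)) Hm Hn => *; lra.
exists z; first exact: Mcl uz.
move=> x Mx; rewrite rdotC.
have c_le n : (rin (u n) x - phi x) ^+ 2 <= n.+1%:R^-1 * nsq x.
  apply: discr_le; rewrite ?sqn_ge0 ?invr_gt0 // => t.
  have := dJ _ (ML t _ _ (Mu n) Mx); have := Ju n.
  rewrite /J sqnD sqnZr rdotZr phiL; move: (n.+1%:R^-1) => ? *; lra.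
apply/esym/eqP; rewrite -subr_eq0 -sqrf_eq0 eq_le sqr_ge0 andbT.
apply/ler_addgt0Pr => e e0; rewrite add0r.
have [s0 sp] : 0 <= nsq x /\ 0 < nsq x + 1 by have := sqn_ge0 inner x; split; lra.
pose e' := e / (4 * (nsq x + 1)).
have e'0 : 0 < e' by rewrite divr_gt0 ?mulr_gt0.
have e'E : 4 * e' * nsq x <= e.
  have E : 4 * e' * (nsq x + 1) = e by rewrite /e'; field; rewrite gt_eqF.
  nra.
have [N1 H1] := uz _ e'0; have [N2 H2] := natSinv_small e'0.
pose n := maxn N1 N2.
have {}H1 := H1 n (leq_maxl _ _); have {}H2 := H2 n (leq_maxr _ _).
have cs := cauchy_schwarz inner (z - u n) x.
have := c_le n; rewrite sqnBC rdotBl in cs.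
have : 0 <= ((rin z x - rin (u n) x) - (rin (u n) x - phi x)) ^+ 2 by exact: sqr_ge0.
move=> h1 h2.
have h3 : nsq (u n - z) * nsq x <= e' * nsq x by exact: ler_wpM2r.
have h4 : n.+1%:R^-1 * nsq x <= e' * nsq x by exact: ler_wpM2r.
move: (n.+1%:R^-1) h3 h4 cs h2 => *; nra.
Qed.

End HilbertBasics.

(** * The Hilbert sum of a sequence of Hilbert spaces *)

Section HilbertSum.
Local Open Scope classical_set_scope.
Variables (R : realType) (E : nat -> hilbertType R).

Definition square_summable (x : forall n, E n) : Prop :=
  exists M : R, forall n, \sum_(0 <= k < n) nsq (x k) <= M.

Record hsum := HSum {
  coord :> forall n, E n;
  coordP : square_summable coord }.

HB.instance Definition _ := gen_eqMixin hsum.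
HB.instance Definition _ := gen_choiceMixin hsum.

Lemma hsum_ext (x y : hsum) : (forall n, x n = y n) -> x = y.
Proof.
case: x y => [x xP] [y yP] /= xy.
have {}xy : x = y by apply: functional_extensionality_dep.
by move: xP yP; rewrite xy => xP yP; congr HSum.
Qed.

Lemma square_summable0 : square_summable (fun n => 0 : E n).
Proof. by exists 0 => n; rewrite big1 // => k _; rewrite sqn0. Qed.

Lemma square_summableD (x y : hsum) : square_summable (fun n => x n + y n).
Proof.
case: x y => [x [M xM]] [y [N yN]]; exists (2 * M + 2 * N) => n.
apply: (@le_trans _ _ (\sum_(0 <= k < n) (2 * nsq (x k) + 2 * nsq (y k)))).
  by apply: ler_sum => k _; exact: sqnD_le.
by rewrite big_split /= -!mulr_sumr lerD // ler_pM2l.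
Qed.

Lemma square_summableN (x : hsum) : square_summable (fun n => - x n).
Proof.
case: x => [x [M xM]]; exists M => n.
by under eq_bigr do rewrite sqnN.
Qed.

Lemma square_summableZ (a : R[i]) (x : hsum) : square_summable (fun n => a *: x n).
Proof.
case: x => [x [M xM]]; exists (Normc.normc a ^+ 2 * M) => n.
under eq_bigr do rewrite sqnZ.
by rewrite -mulr_sumr ler_wpM2l ?sqr_ge0.
Qed.

Definition hsum0 := HSum square_summable0.
Definition hsumD x y := HSum (square_summableD x y).
Definition hsumN x := HSum (square_summableN x).
Definition hsumZ a x := HSum (square_summableZ a x).

Lemma hsumDA : associative hsumD.
Proof. by move=> x y z; apply: hsum_ext => n /=; rewrite addrA. Qed.
Lemma hsumDC : commutative hsumD.
Proof. by move=> x y; apply: hsum_ext => n /=; rewrite addrC. Qed.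
Lemma hsum0D : left_id hsum0 hsumD.
Proof. by move=> x; apply: hsum_ext => n /=; rewrite add0r. Qed.
Lemma hsumND : left_inverse hsum0 hsumN hsumD.
Proof. by move=> x; apply: hsum_ext => n /=; rewrite addNr. Qed.

HB.instance Definition _ := GRing.isZmodule.Build hsum hsumDA hsumDC hsum0D hsumND.

Lemma hsumZA a b x : hsumZ a (hsumZ b x) = hsumZ (a * b) x.
Proof. by apply: hsum_ext => n /=; rewrite scalerA. Qed.
Lemma hsum1Z : left_id 1 hsumZ.
Proof. by move=> x; apply: hsum_ext => n /=; rewrite scale1r. Qed.
Lemma hsumZDr : right_distributive hsumZ +%R.
Proof. by move=> a x y; apply: hsum_ext => n /=; rewrite scalerDr. Qed.
Lemma hsumZDl x : {morph hsumZ^~ x : a b / a + b >-> a + b}.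
Proof. by move=> a b; apply: hsum_ext => n /=; rewrite scalerDl. Qed.

HB.instance Definition _ :=
  GRing.Zmodule_isLmodule.Build R[i] hsum hsumZA hsum1Z hsumZDr hsumZDl.

Lemma coordD (x y : hsum) n : (x + y) n = x n + y n. Proof. by []. Qed.
Lemma coordN (x : hsum) n : (- x) n = - x n. Proof. by []. Qed.
Lemma coordZ a (x : hsum) n : (a *: x) n = a *: x n. Proof. by []. Qed.

Definition rpart (x y : hsum) : R^nat := fun n => \sum_(0 <= k < n) rin (x k) (y k).
Definition rsum (x y : hsum) : R := limn (rpart x y).

Lemma nsq_part_nd (x : hsum) : nondecreasing_seq (rpart x x).
Proof.
apply/nondecreasing_seqP => n.
by rewrite /rpart big_nat_recr //= lerDl sqn_ge0.
Qed.

Lemma nsq_part_cvg (x : hsum) : cvgn (rpart x x).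
Proof.
apply: nondecreasing_is_cvgn; first exact: nsq_part_nd.
by case: (coordP x) => M xM; exists M => _ [n _ <-]; exact: xM.
Qed.

(** Polarization turns the convergence of the series of inner products into two
    instances of monotone convergence. *)
Lemma rpart_polar (x y : hsum) :
  rpart x y = (fun n => 4^-1 * (rpart (x + y) (x + y) n - rpart (x - y) (x - y) n)).
Proof.
apply/funext => n; rewrite /rpart -sumrB mulr_sumr; apply: eq_bigr => k _.
rewrite coordD -/(sqn inner (x k + y k)) sqnD.
rewrite coordD coordN -/(sqn inner (x k - y k)) sqnB; lra.
Qed.

Lemma rpart_cvg x y : rpart x y @ \oo --> rsum x y.
Proof.
rewrite /rsum; suff : cvgn (rpart x y) by [].
rewrite rpart_polar; apply: is_cvgMr; apply: is_cvgB; exact: nsq_part_cvg.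
Qed.

Lemma rsumE x y l : rpart x y @ \oo --> l -> rsum x y = l.
Proof. by move=> xyl; apply: cvg_lim. Qed.

Lemma rsumDl x y z : rsum (x + y) z = rsum x z + rsum y z.
Proof.
apply: rsumE; have -> : rpart (x + y) z = rpart x z \+ rpart y z.
  by apply/funext => n; rewrite /= /rpart -big_split; apply: eq_bigr => k _; rewrite rdotDl.
by apply: cvgD; exact: rpart_cvg.
Qed.

Lemma rsumC x y : rsum x y = rsum y x.
Proof.
by rewrite /rsum; congr (limn _); apply/funext => n; apply: eq_bigr => k _; rewrite rdotC.
Qed.

Lemma rsumZl (a : R) x y : rsum (a%:C *: x) y = a * rsum x y.
Proof.
apply: rsumE; have -> : rpart (a%:C *: x) y = (fun n => a * rpart x y n).
  by apply/funext => n; rewrite /= /rpart mulr_sumr; apply: eq_bigr => k _; rewrite rdotZl.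
by apply: cvgMr; exact: rpart_cvg.
Qed.

Lemma rsumNl x y : rsum (- x) y = - rsum x y.
Proof.
have := rsumZl (-1) x y; rewrite mulN1r => <-; congr rsum.
by apply: hsum_ext => n /=; rewrite (_ : (-1)%:C = -1) ?scaleN1r // rmorphN1.
Qed.

Lemma rsumiC x y : rsum ('i%C *: x) y = - rsum x ('i%C *: y).
Proof.
rewrite -rsumNl /rsum; congr (limn _); apply/funext => n.
by apply: eq_bigr => k _ /=; rewrite rdotiC rdotNl.
Qed.

(** The imaginary part of <x, y> is the real part of <x, i y>. *)
Definition hdot x y : R[i] := rsum x y +i* rsum x ('i%C *: y).

Lemma hdot_zmod_l y : zmod_morphism (hdot ^~ y).
Proof. by move=> x x'; rewrite /hdot !rsumDl !rsumNl. Qed.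

Lemma hdotC x y : hdot x y = (-1) ^+ false * Num.conj (hdot y x).
Proof.
rewrite expr0 mul1r /hdot -[Num.conj _]/(_ +i* _).
by rewrite rsumC (rsumC y ('i%C *: x)) rsumiC opprK.
Qed.

Lemma hdot_scale_l y : scalable_for *%R (hdot ^~ y).
Proof.
move=> a x; rewrite scale_ReIm /hdot !rsumDl !rsumZl !rsumiC.
rewrite scalerA -expr2 sqr_i scaleN1r.
rewrite (rsumC x (- y)) rsumNl (rsumC y) opprK; case: a => a b /=.
by congr (_ +i* _); rewrite /=; ring.
Qed.

Lemma hdot_zmod_r x : zmod_morphism (hdot x).
Proof.
move=> y y'; rewrite hdotC (hdotC x y) (hdotC x y') !expr0 !mul1r.
by rewrite hdot_zmod_l rmorphB.
Qed.

Lemma hdot_scale_r x : scalable_for (Num.conj \; *%R) (hdot x).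
Proof.
move=> a y; rewrite hdotC (hdotC x y) !expr0 !mul1r.
by rewrite hdot_scale_l rmorphM.
Qed.

HB.instance Definition _ := @isBilinear.Build R[i] hsum hsum R[i] *%R
  (Num.conj \; *%R) hdot hdot_zmod_l hdot_zmod_r hdot_scale_l hdot_scale_r.
HB.instance Definition _ := @isHermitianSesquilinear.Build R[i] hsum false
  Num.conj hdot hdotC.

Lemma rsum_part_le (x : hsum) n : rpart x x n <= rsum x x.
Proof. apply: nondecreasing_cvgn_le; [exact: nsq_part_nd|exact: nsq_part_cvg]. Qed.

Lemma rsum_coord_le (x : hsum) n : nsq (x n) <= rsum x x.
Proof.
apply: le_trans (rsum_part_le x n.+1); rewrite /rpart big_nat_recr //= lerDr.
by apply: sumr_ge0 => k _; exact: sqn_ge0.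
Qed.

Lemma rsum_le (x : hsum) (M : R) : (forall n, rpart x x n <= M) -> rsum x x <= M.
Proof. by move=> xM; apply: limr_le; [exact: nsq_part_cvg | exact: nearW]. Qed.

Lemma hdot_gt0 x : x != 0 -> 0 < hdot x x.
Proof.
move=> x0.
have xx0 : rsum x ('i%C *: x) = 0.
  by have := rsumiC x x; rewrite rsumC; lra.
rewrite /hdot xx0 complexr0 ltcR lt_def (le_trans _ (rsum_part_le x 0)) ?andbT; last first.
  by rewrite /rpart big_nil.
apply: contraNneq x0 => xx; apply/eqP/hsum_ext => n; apply: (@sqn_eq0 _ _ inner).
by apply/eqP; rewrite eq_le sqn_ge0 andbT -xx rsum_coord_le.
Qed.

HB.instance Definition _ := @isDotProduct.Build R[i] hsum hdot hdot_gt0.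

Definition hsum_dot : {dot hsum for (Num.conj : R[i] -> R[i])} := hdot.

Definition hsum_norm (x : hsum) : R[i] := (hnrm hsum_dot x)%:C.

Lemma hsum_normD x y : hsum_norm (x + y) <= hsum_norm x + hsum_norm y.
Proof. by rewrite -rmorphD lecR hnrmD. Qed.

Lemma hsum_normZ (a : R[i]) x : hsum_norm (a *: x) = `|a| * hsum_norm x.
Proof. by rewrite /hsum_norm hnrmZ rmorphM; congr (_ * _); rewrite normc_def; case: a. Qed.

Lemma hsum_norm_eq0 x : hsum_norm x = 0 -> x = 0.
Proof.
move=> /complexI x0; apply: (@sqn_eq0 _ _ hsum_dot).
by rewrite -hnrm_sqr x0 expr0n.
Qed.

HB.instance Definition _ := @Lmodule_isNormed.Build R[i] hsum hsum_norm
  hsum_normD hsum_normZ hsum_norm_eq0.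

Lemma hsum_ballE (x y : hsum) (e : R) : 0 < e ->
  ball x e%:C y <-> sqn hsum_dot (x - y) < e ^+ 2.
Proof.
move=> e0; rewrite -ball_normE /= -[`|_|]/(hsum_norm _) /hsum_norm ltcR.
by rewrite -hnrm_sqr ltr_pXn2r ?nnegrE ?hnrm_ge0 // ltW.
Qed.

Lemma coord_seq_to (x : nat -> hsum) (l : forall k, E k) :
  (forall k, seq_to (fun n => x n k) (l k)) ->
  forall K (e : R), 0 < e -> exists N, forall n, (N <= n)%N ->
    \sum_(0 <= k < K) nsq (x n k - l k) <= e.
Proof.
move=> xl; elim=> [|K IH] e e0.
  by exists 0%N => n _; rewrite big_nil ltW.
have e20 : 0 < e / 2 by rewrite divr_gt0.
have [N1 H1] := IH _ e20; have [N2 H2] := xl K _ e20.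
exists (maxn N1 N2) => n; rewrite geq_max => /andP[/H1 h1 /H2 h2].
rewrite big_nat_recr //=; lra.
Qed.

(** A Cauchy filter is approximated by a Cauchy sequence [x n]; the limit [l] is
    taken coordinatewise, and bounds on the finite partial sums of the
    |x n k - l k|^2 that are uniform in the number of terms show that [l] is
    square summable and that the filter converges to it. *)
Lemma hsum_complete (F : set_system hsum) : ProperFilter F -> cauchy F -> cvg F.
Proof.
move=> FF /cauchyP Fc.
have /choice[x xF] : forall n : nat, exists x : hsum,
    F [set y | sqn hsum_dot (x - y) < n.+1%:R^-1].
  move=> n; have s0 : 0 < Num.sqrt n.+1%:R^-1 :> R by rewrite sqrtr_gt0 invr_gt0.
  have [|x xF] := Fc (Num.sqrt n.+1%:R^-1)%:C; first by rewrite ltcR.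
  exists x; apply: filterS xF => y /(hsum_ballE _ _ s0) /=.
  by rewrite sqr_sqrtr ?invr_ge0.
have xx m n : sqn hsum_dot (x m - x n) <= 2 * m.+1%:R^-1 + 2 * n.+1%:R^-1.
  have [y [/= ym yn]] := filter_ex (filterI (xF m) (xF n)).
  have := sqnD_le hsum_dot (x m - y) (y - x n); rewrite addrA subrK (sqnBC _ y (x n)).
  move: (m.+1%:R^-1) (n.+1%:R^-1) ym yn => *; lra.
have xlex k : exists l : E k, seq_to (fun n => x n k) l.
  apply: hilbert_complete => e e0.
  have [|N HN] := @natSinv_small _ (e / 4); first by rewrite divr_gt0.
  exists N => m n /HN Hm /HN Hn.
  apply: le_trans (rsum_coord_le (x m - x n) k) _; apply: le_trans (xx m n) _.
  move: (m.+1%:R^-1) (n.+1%:R^-1) Hm Hn => *; lra.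
pose l k := sval (cid (xlex k)).
have xl k : seq_to (fun n => x n k) (l k) := svalP (cid (xlex k)).
(* Twice the bound 4 / (n + 1) on |x n - x m|^2 for m >= n; for fixed K the sum
   of the |x m k - l k|^2 vanishes as m grows. *)
have xlK n K : \sum_(0 <= k < K) nsq (x n k - l k) <= 8 * n.+1%:R^-1.
  apply/ler_addgt0Pr => e e0; have e20 : 0 < e / 2 by rewrite divr_gt0.
  have [N HN] := coord_seq_to xl K e20.
  pose m := maxn N n; have {}HN := HN m (leq_maxl _ _).
  have mn : (m.+1%:R^-1 : R) <= n.+1%:R^-1.
    by rewrite lef_pV2 ?posrE // ler_nat ltnS leq_maxr.
  apply: (@le_trans _ _ (\sum_(0 <= k < K) (2 * nsq (x n k - x m k) + 2 * nsq (x m k - l k)))).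
    apply: ler_sum => k _; have := sqnD_le inner (x n k - x m k) (x m k - l k).
    by rewrite addrA subrK.
  rewrite big_split /= -!mulr_sumr.
  have h1 := rsum_part_le (x n - x m) K; have h2 := xx n m.
  move: HN h1 h2; rewrite /sqn /rdot /= /rpart.
  move: (n.+1%:R^-1) (m.+1%:R^-1) mn => *; lra.
have lP : square_summable l.
  have [M xM] := coordP (x 0%N).
  exists (2 * M + 2 * 8) => n.
  apply: (@le_trans _ _ (\sum_(0 <= k < n) (2 * nsq (x 0%N k) + 2 * nsq (x 0%N k - l k)))).
    apply: ler_sum => k _; have := sqnD_le inner (x 0%N k) (l k - x 0%N k).
    by rewrite addrC subrK (sqnBC _ (l k)).
  rewrite big_split /= -!mulr_sumr.
  by have := xM n; have := xlK 0%N n; rewrite invr1; lra.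
apply/cvg_ex; exists (HSum lP).
apply/cvg_ballP => _/gt0_complexP[e e0 ->].
have [|N HN] := @natSinv_small _ (e ^+ 2 / 32); first by rewrite divr_gt0 ?exprn_gt0.
have {}HN := HN N (leqnn _).
apply: filterS (xF N) => y /= xy; apply/(hsum_ballE _ _ e0).
have h1 : sqn hsum_dot (x N - HSum lP) <= 8 * N.+1%:R^-1 by apply: rsum_le => K; exact: xlK.
have := sqnD_le hsum_dot (HSum lP - x N) (x N - y); rewrite addrA subrK (sqnBC _ (HSum lP) (x N)).
have : 0 < e ^+ 2 by exact: exprn_gt0.
move: (N.+1%:R^-1) (e ^+ 2) HN xy h1 => *; lra.
Qed.

HB.instance Definition _ := Uniform_isComplete.Build hsum hsum_complete.

Lemma hsum_sqr_norm (x : hsum) : `|x| ^+ 2 = hsum_dot x x.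
Proof. by rewrite (sqnE hsum_dot) -hnrm_sqr rmorphXn. Qed.

HB.instance Definition _ := isHilbert.Build R hsum hsum_sqr_norm.

End HilbertSum.

(** * Adjoints, lifts and reflections *)

Section Operators.
Variable R : realType.
Implicit Types H K : hilbertType R.

Lemma ex_bounded_op H K (f : H -> K) (M : R) :
  linear f -> (forall x, nsq (f x) <= M * nsq x) ->
  exists A : 'B(H, K), forall x, A x = f x.
Proof.
move=> lf fM.
pose g : {linear H -> K} := HB.pack f (GRing.isLinear.Build _ _ _ _ f lf).
by exists (@mk_bounded _ _ _ g M fM).
Qed.

Lemma adjoint_exists H K (A : 'B(H, K)) : exists A' : 'B(K, H), is_adjoint A A'.
Proof.
have [M M0 AM] := bounded_nsq A.
have /choice[g gP] : forall y, exists z, forall x, rin (A x) y = rin x z.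
  move=> y; have [||||||z _ zP] := @riesz_on _ H (fun=> True) (fun x => rin (A x) y) (M * nsq y) => //.
  - by move=> a x x'; rewrite linearD linearZ rdotDl rdotZl.
  - by rewrite mulr_ge0 ?sqn_ge0 // ltW.
  - move=> x; apply: le_trans (cauchy_schwarz _ _ _) _.
    by rewrite mulrAC ler_wpM2r ?sqn_ge0.
  by exists z => x; rewrite zP.
have gA x y : inner (A x) y = inner x (g y).
  by rewrite !dotE -gP; congr (_ +i* _); rewrite -[LHS]opprK -[RHS]opprK -!rdotiC -linearZ gP.
have gl : linear g.
  move=> a y y'; apply: rin_inj => x; rewrite /rdot -gA.
  by rewrite !linearDr !linearZr_LR /= -!gA.
have [] := @ex_bounded_op _ _ g M gl.
  move=> y; have := cauchy_schwarz inner (A (g y)) y; rewrite gP -/(nsq (g y)).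
  have [->|y0] := eqVneq (nsq (g y)) 0; first by rewrite mulr_ge0 ?sqn_ge0 // ltW.
  have gp : 0 < nsq (g y) by rewrite lt_def y0 sqn_ge0.
  move=> h; rewrite -(ler_pM2l gp) mulrA [_ * M]mulrC.
  by rewrite -expr2 (le_trans h) // ler_wpM2r ?sqn_ge0.
by move=> A' A'E; exists A' => x y; rewrite gA A'E.
Qed.

(** Taking adjoints turns the lift condition into an intertwining relation for
    the compression P to H.  When B is a block operator, that relation only
    involves the first coordinate, so no adjoint of B has to be computed. *)
Lemma lift_criterion H K (iota : 'B(H, K)) (P : 'B(K, H)) (A : 'B(H)) (B : 'B(K)) :
  is_adjoint iota P -> (forall y, P (B y) = A (P y)) -> is_lift iota A B.
Proof.
move=> iP PB.
have [A' AA'] := adjoint_exists A; have [B' BB'] := adjoint_exists B.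
exists A', B'; split=> // x; apply: rin_inj => y.
rewrite -(rin_adjoint BB') rdotC (rin_adjoint iP) PB rdotC (rin_adjoint AA').
by rewrite rdotC -(rin_adjoint iP) rdotC.
Qed.

Lemma polarization (X : lmodType R[i]) H (p r : {linear X -> H}) :
  (forall h, nsq (p h) = nsq (r h)) -> forall h h', rin (p h) (p h') = rin (r h) (r h').
Proof.
by move=> pr h h'; have := pr (h + h'); rewrite !linearD !sqnD !pr; lra.
Qed.

(** The reflection equals 1 on the subspace N of the vectors orthogonal to all
    [p h - r h] and -1 on its complement.  The vector [p h + r h] lies in N,
    because the two families have the same inner products and are orthogonal to
    each other; so [p h], the half-sum of [p h + r h] and [p h - r h], is sent
    to [r h]. *)
Lemma reflection (X : lmodType R[i]) H (p r : {linear X -> H}) :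
  (forall h, nsq (p h) = nsq (r h)) -> (forall h h', rin (p h) (r h') = 0) ->
  exists S : 'B(H), [/\ forall x, S (S x) = x, forall x, nsq (S x) = nsq x &
    forall h, S (p h) = r h].
Proof.
move=> pr_nsq pr0.
pose N z := forall h, rin z (p h - r h) = 0.
have NiZ z : N z -> N ('i%C *: z).
  by move=> Nz h; rewrite rdotiC scalerBr -!linearZ Nz oppr0.
have ND z z' : N z -> N z' -> N (z + z') by move=> h1 h2 h; rewrite rdotDl h1 h2 addr0.
have NR (a : R) z : N z -> N (a%:C *: z) by move=> h1 h; rewrite rdotZl h1 mulr0.
have N0 : N 0 by move=> h; rewrite rdot0l.
have half (x : H) : (2^-1)%:C *: (x *+ 2) = x.
  rewrite -[x *+ 2]scaler_nat scalerA -(rmorph_nat (real_complex R) 2).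
  by rewrite -rmorphM mulVf // scale1r.
have NZ (a : R[i]) z : N z -> N (a *: z).
  by move=> Nz; rewrite scale_ReIm; apply: ND; apply: (NR); rewrite ?scalerA //; apply: NiZ.
have NB z z' : N z -> N z' -> N (z - z').
  by move=> Nz Nz'; apply: ND => //; rewrite -scaleN1r; exact: NZ.
have projex x0 : exists z, N z /\ forall x, N x -> rin x (x0 - z) = 0.
  have [||||||z Nz zP] := @riesz_on _ H N (fun x => rin x x0) (nsq x0).
  - exact: N0.
  - by move=> a x y Nx Ny; apply: ND => //; exact: NR.
  - move=> u l Nu ul h; apply/eqP; rewrite -sqrf_eq0 eq_le sqr_ge0 andbT.
    apply/ler_addgt0Pr => e e0; rewrite add0r; set w := p h - r h.
    have wp : 0 < nsq w + 1 by have := sqn_ge0 inner w; lra.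
    have e'0 : 0 < e / (nsq w + 1) by rewrite divr_gt0.
    have [n /(_ n (leqnn _)) hn] := ul _ e'0.
    have -> : rin l w = - rin (u n - l) w by rewrite rdotBl Nu sub0r opprK.
    rewrite sqrrN (le_trans (cauchy_schwarz _ _ _)) //.
    rewrite ler_pdivlMr // in hn; apply: le_trans hn.
    by rewrite ler_wpM2l ?sqn_ge0 // lerDl.
  - by move=> a x y; rewrite rdotDl rdotZl.
  - exact: sqn_ge0.
  - by move=> x; rewrite mulrC cauchy_schwarz.
  by exists z; split=> // x Nx; rewrite rdotBr zP // subrr.
have [P PP] := choice projex.
have PN x : N (P x) by case: (PP x).
have Porth x z : N z -> rin z (x - P x) = 0 by case: (PP x) => _; apply.
have Puniq x z : N z -> (forall y, N y -> rin y (x - z) = 0) -> P x = z.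
  move=> Nz zP; apply/eqP; rewrite -subr_eq0; apply/eqP/(@sqn_eq0 _ _ inner).
  have NPz : N (P x - z) by exact: NB.
  have := Porth x _ NPz; have := zP _ NPz.
  rewrite [in LHS]rdotBr [in X in _ -> X = _ -> _]rdotBr /sqn [X in _ -> _ -> X = _]rdotBr; lra.
have Plin : linear P.
  move=> a x y; apply: Puniq; first by apply: ND => //; exact: NZ.
  move=> z Nz; rewrite opprD addrACA -scalerBr rdotDr (Porth y) // addr0.
  rewrite scale_ReIm rdotDr !rdotZr Porth // -[rin z _]opprK -rdotiC Porth; last exact: NiZ.
  by rewrite oppr0 !mulr0 addr0.
(* With P the projection onto N, the reflection is 2 P - 1. *)
pose S0 x := P x *+ 2 - x.
have S0lin : linear S0.
  move=> a x y; rewrite /S0 Plin mulrnDl scalerBr -scalerMnr opprD.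
  by rewrite addrACA.
have S0nsq x : nsq (S0 x) = nsq x.
  have o := Porth x (P x) (PN x).
  have -> : S0 x = P x - (x - P x) by rewrite /S0 mulr2n opprB addrA.
  rewrite -[in RHS](subrK (P x) x) [X in _ = sqn _ X]addrC.
  by move: (x - P x) o => w o; rewrite sqnB sqnD o; ring.
have [|S SE] := @ex_bounded_op _ _ S0 1 S0lin; first by move=> x; rewrite mul1r S0nsq.
exists S; split.
- move=> x; rewrite !SE {1}/S0.
  have -> : P (S0 x) = P x.
    apply: Puniq => // y Ny.
    have -> : S0 x - P x = - (x - P x) by rewrite /S0 mulr2n opprB addrAC addrK.
    by rewrite rdotNr Porth // oppr0.
  by rewrite /S0 opprB addrC subrK.
- by move=> x; rewrite SE S0nsq.
- move=> h; rewrite SE /S0.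
  have -> : P (p h) = (2^-1)%:C *: (p h + r h).
    apply: Puniq.
      apply: NR => h'; rewrite rdotDl !rdotBr (polarization pr_nsq h).
      rewrite pr0 (rdotC _ (r h) (p h')) pr0; lra.
    move=> y Ny.
    have -> : p h - (2^-1)%:C *: (p h + r h) = (2^-1)%:C *: (p h - r h).
      have {1}-> : p h = (2^-1)%:C *: (p h + p h).
        by rewrite -mulr2n half.
      by rewrite -scalerBr opprD addrA addrK.
    by rewrite rdotZr Ny mulr0.
  rewrite scalerMnr half.
  by rewrite addrAC subrr add0r.
Qed.

End Operators.

(** * Operators on Hilbert sums *)

Section SumOperators.
Local Open Scope classical_set_scope.
Variable R : realType.
Implicit Types (H F : hilbertType R) (E : nat -> hilbertType R).

Lemma hsum_part_le E (x : hsum E) n : \sum_(0 <= k < n) nsq (x k) <= nsq x.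
Proof. exact: (rsum_part_le x n). Qed.

Lemma hsum_coord_le E (x : hsum E) n : nsq (x n) <= nsq x.
Proof. exact: rsum_coord_le. Qed.

Lemma hsum_nsq_le E (x : hsum E) (M : R) :
  (forall n, \sum_(0 <= k < n) nsq (x k) <= M) -> nsq x <= M.
Proof. exact: (@rsum_le _ _ x M). Qed.

Lemma ex_hsum_op H E (f : forall n, H -> E n) (M : R) :
  (forall n, linear (f n)) ->
  (forall x n, \sum_(0 <= k < n) nsq (f k x) <= M * nsq x) ->
  exists A : 'B(H, hsum E), forall x n, A x n = f n x.
Proof.
move=> fl fM.
have fP x : square_summable (fun n => f n x) by exists (M * nsq x); exact: fM.
have [||A AE] := @ex_bounded_op _ _ (hsum E) (fun x => HSum (fP x)) M.
- by move=> a x y; apply: hsum_ext => n /=; rewrite fl.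
- by move=> x; apply: hsum_nsq_le => n; exact: fM.
by exists A => x n; rewrite AE.
Qed.

Lemma ex_coord E i : exists P : 'B(hsum E, E i), forall x, P x = x i.
Proof.
apply: (@ex_bounded_op _ _ _ _ 1) => // x; rewrite mul1r; exact: hsum_coord_le.
Qed.

Lemma big_nat_single i n (u : nat -> R) : (i < n)%N ->
  (forall k, k != i -> u k = 0) -> \sum_(0 <= k < n) u k = u i.
Proof.
move=> i_n u0; rewrite (bigD1_seq i) ?mem_index_iota ?iota_uniq //=.
by rewrite big1 ?addr0.
Qed.

Lemma ex_inj E i : exists J : 'B(E i, hsum E),
  (forall v, J v i = v) /\ (forall v n, n != i -> J v n = 0).
Proof.
pose f n (v : E i) : E n := @dfwith nat (fun k => E k) (fun=> 0) i v n.
have fi v : f i v = v by rewrite /f dfwithin.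
have fn v n : n != i -> f n v = 0 by move=> ni; rewrite /f dfwithout // eq_sym.
have [||J JE] := @ex_hsum_op _ E f 1.
- move=> n a x y; have [ni|/negP/negP ni] := boolP (n == i).
    by move: (eqP ni) => {ni} ->; rewrite !fi.
  by rewrite !fn // scaler0 addr0.
- move=> x n; rewrite mul1r; have [i_n|n_i] := ltnP i n.
    by rewrite (big_nat_single i_n) ?fi // => k ki; rewrite fn // sqn0.
  rewrite big_nat_cond big1 ?sqn_ge0 // => k; rewrite andbT => /andP[_ kn].
  by rewrite fn ?sqn0 // neq_ltn (leq_trans kn n_i).
by exists J; split=> [v|v n ni]; rewrite JE ?fi ?fn.
Qed.

Lemma rin_inj_coord E i (J : 'B(E i, hsum E)) :
  (forall v, J v i = v) -> (forall v n, n != i -> J v n = 0) ->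
  forall v y, rin (J v) y = rin v (y i).
Proof.
move=> Ji Jn v y; apply: rsumE; apply: cvg_near_cst; exists i.+1 => // n /= i_n.
by rewrite /rpart (big_nat_single i_n) ?Ji // => k ki; rewrite Jn // rdot0l.
Qed.

Lemma hsum_orth E (x y : hsum E) : (forall n, rin (x n) (y n) = 0) -> rin x y = 0.
Proof.
move=> xy; apply: rsumE; apply: cvg_near_cst; apply: nearW => n.
by rewrite /rpart big1.
Qed.

Definition ext_fam H F (n : nat) : hilbertType R := if n is _.+1 then F else H.

(** Under the hypotheses below, the columns of the block matrix with diagonal
    T, alpha 0, alpha 1, ... and subdiagonal c, beta 0, beta 1, ... are isometric
    and mutually orthogonal, so the matrix defines an isometry. *)
Section Bidiagonal.
Variables (H F : hilbertType R) (T : {linear H -> H}) (c : {linear H -> F}).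
Variables (alpha beta : nat -> {linear F -> F}).
Hypotheses (Tc : forall h, nsq (T h) + nsq (c h) = nsq h).
Hypotheses (ab : forall n x, nsq (alpha n x) + nsq (beta n x) = nsq x).
Hypotheses (ca : forall h x, rin (c h) (alpha 0 x) = 0).
Hypotheses (ba : forall n x y, rin (beta n x) (alpha n.+1 y) = 0).

Definition bidiag_coord n (x : hsum (ext_fam H F)) : ext_fam H F n :=
  match n return ext_fam H F n with
  | 0 => T (x 0%N)
  | 1 => c (x 0%N) + alpha 0 (x 1%N)
  | m.+2 => beta m (x m.+1) + alpha m.+1 (x m.+2)
  end.

Lemma bidiag_coord_linear n : linear (bidiag_coord n).
Proof.
case: n => [|[|n]] a x y /=.
- exact: (linearP T).
- rewrite (linearP c) (linearP (alpha 0)) scalerDr.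
  by rewrite !addrA (addrAC (a *: c (x 0%N))).
- rewrite (linearP (beta n)) (linearP (alpha n.+1)) scalerDr.
  by rewrite !addrA (addrAC (a *: beta n (x n.+1))).
Qed.

Lemma bidiag_coord_sum (x : hsum (ext_fam H F)) n :
  \sum_(0 <= k < n.+2) nsq (bidiag_coord k x) =
  \sum_(0 <= k < n.+1) nsq (x k) + nsq (alpha n (x n.+1)).
Proof.
elim: n => [|n IH].
  rewrite !big_nat_recr //= !big_nil !add0r.
  by rewrite sqnD ca mulr0 addr0 addrA Tc.
rewrite big_nat_recr // [in RHS]big_nat_recr //= IH.
rewrite sqnD ba mulr0 addr0 !addrA; congr (_ + _).
by rewrite -!addrA ab.
Qed.

Lemma ex_bidiagonal : exists V : 'B(hsum (ext_fam H F)),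
  [/\ forall x, nsq (V x) = nsq x, forall x, V x 0%N = T (x 0%N),
      forall x, V x 1%N = c (x 0%N) + alpha 0 (x 1%N) &
      forall x n, V x n.+2 = beta n (x n.+1) + alpha n.+1 (x n.+2)].
Proof.
have up x n : \sum_(0 <= k < n) nsq (bidiag_coord k x) <= nsq x.
  apply: le_trans (hsum_part_le x n.+2).
  apply: (@le_trans _ _ (\sum_(0 <= k < n.+2) nsq (bidiag_coord k x))).
    by rewrite 2?big_nat_recr //= -addrA lerDl addr_ge0 ?sqn_ge0.
  rewrite bidiag_coord_sum [leRHS]big_nat_recr //= lerD2l.
  by rewrite -(ab n (x n.+1)) lerDl sqn_ge0.
have [||V VE] := @ex_hsum_op _ _ bidiag_coord 1.
- exact: bidiag_coord_linear.
- by move=> x n; rewrite mul1r.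
exists V; split=> [x|x|x|x n]; rewrite ?VE //.
apply/eqP; rewrite eq_le; apply/andP; split; apply: hsum_nsq_le => n.
  by under eq_bigr do rewrite VE; exact: up.
apply: le_trans (hsum_part_le (V x) n.+2).
under [leRHS]eq_bigr do rewrite VE.
rewrite bidiag_coord_sum big_nat_recr //= -addrA lerDl addr_ge0 ?sqn_ge0 //.
Qed.

End Bidiagonal.

End SumOperators.

(** * A substitute for the square root of 1 - T^* T *)

Section Defect.
Variables (R : realType) (H : hilbertType R).

Section Series.
Local Open Scope classical_set_scope.
Variable B0 : {linear H -> H}.
Hypotheses (B0sym : forall x y, rin (B0 x) y = rin x (B0 y)).
Hypotheses (B0ge0 : forall x, 0 <= rin (B0 x) x).
Hypotheses (B0le1 : forall x, rin (B0 x) x <= nsq x).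

Fixpoint defect_seq n : {linear H -> H} :=
  if n is m.+1 then defect_seq m \- (defect_seq m \o defect_seq m) else B0.

Lemma defect_seqS n x :
  defect_seq n.+1 x = defect_seq n x - defect_seq n (defect_seq n x).
Proof. by []. Qed.

Lemma defect_seq_sym n x y : rin (defect_seq n x) y = rin x (defect_seq n y).
Proof.
elim: n x y => [|n IH] x y; first exact: B0sym.
by rewrite !defect_seqS rdotBl rdotBr !IH.
Qed.

(** With B = B_n between 0 and 1, adding the inequality <B (x - B x), x - B x> >= 0
    to <B (B x), B x> <= |B x|^2 gives |B x|^2 <= <B x, x>, which is the positivity
    of B - B^2. *)
Lemma defect_seq_bounds n x : 0 <= rin (defect_seq n x) x <= nsq x.
Proof.
elim: n x => [|n IH] x; first by rewrite B0ge0 B0le1.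
set b := defect_seq n in IH *.
have bsym := defect_seq_sym n : forall x y, rin (b x) y = rin x (b y).
have -> : rin (defect_seq n.+1 x) x = rin (b x) x - nsq (b x).
  by rewrite defect_seqS rdotBl (bsym (b x)).
have /andP[h1 h2] := IH (x - b x); have /andP[h3 h4] := IH (b x).
have /andP[h5 h6] := IH x.
have n0 := sqn_ge0 inner (b x).
move: h1; rewrite linearB !rdotBl !rdotBr (bsym (b x) x) -/(sqn inner (b x)) => h1.
by apply/andP; split; lra.
Qed.

Lemma defect_seq_sum n x :
  \sum_(0 <= k < n) nsq (defect_seq k x) = rin (B0 x) x - rin (defect_seq n x) x.
Proof.
elim: n => [|n IH]; first by rewrite big_nil subrr.
rewrite big_nat_recr //= IH rdotBl /= (defect_seq_sym n (defect_seq n x)) /sqn; ring.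
Qed.

(** The sum of the |B_k x|^2 telescopes to <B_0 x, x> - <B_n x, x>.  It is
    therefore bounded, so |B_n x| tends to 0, and with it the remainder
    <B_n x, x>. *)
Lemma ex_sqrt_series : exists D : 'B(H, hsum (fun=> H)),
  forall x, nsq (D x) = rin (B0 x) x.
Proof.
have le n x : \sum_(0 <= k < n) nsq (defect_seq k x) <= rin (B0 x) x.
  by rewrite defect_seq_sum lerBlDr lerDl; case/andP: (defect_seq_bounds n x).
have [||D DE] := @ex_hsum_op _ H (fun=> H) (fun n => defect_seq n) 1.
- by move=> n; exact: linearP.
- by move=> x n; rewrite mul1r (le_trans (le n x)).
exists D => x; apply/eqP; rewrite eq_le; apply/andP; split.
  by apply: hsum_nsq_le => n; under eq_bigr do rewrite DE; exact: le.
have part n : \sum_(0 <= k < n) nsq (defect_seq k x) <= nsq (D x).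
  by have := hsum_part_le (D x) n; under eq_bigr do rewrite DE.
have cvgs : series (fun k => nsq (defect_seq k x)) @ \oo --> lim (series (fun k => nsq (defect_seq k x)) @ \oo).
  apply: nondecreasing_is_cvgn.
    by apply/nondecreasing_seqP => n; rewrite /series /= big_nat_recr //= lerDl sqn_ge0.
  by exists (nsq (D x)) => _ [n _ <-]; exact: part.
have /cvgrPdist_lt cvg0 := cvg_series_cvg_0 (cvgP _ cvgs).
apply/ler_addgt0Pr => e e0.
have d0 : 0 < e ^+ 2 / (nsq x + 1).
  by rewrite divr_gt0 ?exprn_gt0 // ltr_wpDl ?sqn_ge0.
have [n _ /(_ n (leqnn _))] := cvg0 _ d0.
rewrite sub0r normrN ger0_norm ?sqn_ge0 // => small.
have /andP[b0 _] := defect_seq_bounds n x.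
suff : rin (defect_seq n x) x <= e by have := part n; rewrite defect_seq_sum; lra.
rewrite -(@ler_pXn2r _ 2) ?nnegrE ?(ltW e0) //.
apply: le_trans (cauchy_schwarz _ _ _) _.
rewrite ltr_pdivlMr ?ltr_wpDl ?sqn_ge0 // in small.
apply: le_trans (ltW small).
by rewrite ler_wpM2l ?sqn_ge0 // lerDl.
Qed.

End Series.

Lemma ex_defect (T : 'B(H)) : contraction_op T ->
  exists D : 'B(H, hsum (fun=> H)), forall h, nsq (T h) + nsq (D h) = nsq h.
Proof.
move=> /contraction_nsq T1; have [T' TT'] := adjoint_exists T.
pose B0 : {linear H -> H} := idfun \- (T' \o T).
have B0E x y : rin (B0 x) y = rin x y - rin (T x) (T y).
  by rewrite rdotBl /= (rdotC _ (T' _)) -(rin_adjoint TT') (rdotC _ (T y)).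
have [|||D DE] := @ex_sqrt_series B0.
- by move=> x y; rewrite B0E (rdotC _ x (B0 y)) B0E !(rdotC _ y) (rdotC _ (T y)).
- by move=> x; rewrite B0E subr_ge0 T1.
- by move=> x; rewrite B0E lerBlDr lerDl sqn_ge0.
by exists D => h; rewrite DE B0E -/(sqn inner h) -/(sqn inner (T h)) addrC subrK.
Qed.

End Defect.

(** * A space with room for both defects *)

Section Parity.
Variables (R : realType) (D : hilbertType R).
Let F := hsum (fun=> D).

Definition swap_index k := if odd k then k.-1 else k.+1.

Lemma swap_sum (u : nat -> R) n :
  \sum_(0 <= k < n.*2) u (swap_index k) = \sum_(0 <= k < n.*2) u k.
Proof.
elim: n => [|n IH]; first by rewrite !big_nil.
rewrite doubleS !big_nat_recr //= IH /swap_index /= odd_double /=.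
by rewrite -!addrA (addrC (u _)).
Qed.

Lemma swap_part_le (x : F) n :
  \sum_(0 <= k < n) nsq (x (swap_index k)) <= nsq x.
Proof.
apply: (@le_trans _ _ (\sum_(0 <= k < n.*2) nsq (x (swap_index k)))).
  rewrite -addnn (big_cat_nat (leq0n n) (leq_addr n n)) /= lerDl.
  by apply: sumr_ge0 => k _; exact: sqn_ge0.
rewrite (swap_sum (fun k => nsq (x k))); exact: hsum_part_le.
Qed.

Lemma swap_nsq_le (x y : F) : (forall k, y k = x (swap_index k)) -> nsq y <= nsq x.
Proof.
move=> yx; apply: hsum_nsq_le => n.
by under eq_bigr do rewrite yx; exact: swap_part_le.
Qed.

Lemma swap_indexK k : swap_index (swap_index k) = k.
Proof.
rewrite /swap_index; have [|ok] := ifPn (odd k); last by rewrite /= ok.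
by case: k => //= k /negbTE ->.
Qed.

(** On D + D + ..., F0 consists of the sequences supported by the even slots and
    F1 of those supported by the odd ones. *)
Lemma ex_parity : exists alpha beta : 'B(hsum (fun=> D)),
  [/\ forall x k, alpha x k = (if odd k then x k.-1 else 0),
      forall x k, beta x k = (if odd k then 0 else x k.+1) &
      forall x, nsq (alpha x) + nsq (beta x) = nsq x].
Proof.
have half (c : nat -> bool) : exists A : 'B(hsum (fun=> D)),
    forall x k, A x k = (if c k then x (swap_index k) else 0).
  have [||A AE] := @ex_hsum_op R F (fun=> D)
      (fun k (x : F) => if c k then x (swap_index k) else 0) 1; last by exists A.
    by move=> k a x y; case: ifP => // _; rewrite scaler0 addr0.
  move=> x n; rewrite mul1r; apply: le_trans (swap_part_le x n); apply: ler_sum => k _.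
  by case: ifP => // _; rewrite sqn0 sqn_ge0.
have [a aE] := half (fun k => odd k); have [b bE] := half (fun k => ~~ odd k).
exists a, b; split=> [x k|x k|x].
- by rewrite aE /swap_index; case: (odd k).
- by rewrite bE /swap_index; case: (odd k).
have ab : rin (a x) (b x) = 0.
  by apply: hsum_orth => n; rewrite aE bE; case: (odd n); rewrite ?rdot0l ?rdot0r.
have abE k : (a x + b x) k = x (swap_index k).
  by rewrite coordD aE bE; case: (odd k); rewrite ?addr0 ?add0r.
have -> : nsq (a x) + nsq (b x) = nsq (a x + b x) by rewrite sqnD ab mulr0 addr0.
apply/eqP; rewrite eq_le; apply/andP; split; apply: swap_nsq_le => k.
  exact: abE.
by rewrite abE swap_indexK.
Qed.

End Parity.

Section Model.
Variables (R : realType) (H : hilbertType R) (T1 T2 : 'B(H)).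
Hypotheses (hT1 : contraction_op T1) (hT2 : contraction_op T2).

(** The slots 0 and 2 are even, so both defect maps have their values in F0, and
    distinct, which makes their ranges orthogonal. *)
Lemma ex_defect_slots : exists (F : hilbertType R) (alpha beta : 'B(F)) (j1 j2 : 'B(H, F)),
  [/\ [/\ forall x, alpha (alpha x) = 0, forall x, beta (beta x) = 0,
          forall x, alpha (beta x) + beta (alpha x) = x,
          forall x, nsq (alpha x) + nsq (beta x) = nsq x &
          forall x y, rin (beta x) (alpha y) = 0],
      [/\ forall h, nsq (T1 h) + nsq (j1 h) = nsq h,
          forall h, beta (j1 h) = 0 & forall h x, rin (j1 h) (alpha x) = 0],
      [/\ forall h, nsq (T2 h) + nsq (j2 h) = nsq h,
          forall h, beta (j2 h) = 0 & forall h x, rin (j2 h) (alpha x) = 0] &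
      forall h h', rin (j1 h) (j2 h') = 0].
Proof.
have [d1 d1E] := ex_defect hT1; have [d2 d2E] := ex_defect hT2.
set D : hilbertType R := hsum (fun=> H) in d1 d1E d2 d2E.
have [a [b [aE bE ab]]] := ex_parity D.
have slot i (d : 'B(H, D)) : ~~ odd i -> exists j : 'B(H, hsum (fun=> D)),
    [/\ forall h n, j h n = if n == i then d h else 0,
        forall h, nsq (j h) = nsq (d h),
        forall h, b (j h) = 0 & forall h x, rin (j h) (a x) = 0].
  move=> oi; have [J [Ji Jn]] := ex_inj (fun=> D) i.
  have rJ := rin_inj_coord Ji Jn.
  have [M M0 dM] := bounded_nsq d.
  have Jnsq v : nsq (J v) = nsq v by rewrite /sqn rJ Ji.
  have [|j jE] := @ex_bounded_op _ _ _ (J \o d) M (linearP _).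
    by move=> x; rewrite /= Jnsq.
  exists j; split.
  - move=> h n; rewrite jE /=; have [->|ni] := eqVneq; first by rewrite Ji.
    by rewrite Jn.
  - by move=> h; rewrite jE Jnsq.
  - move=> h; apply: hsum_ext => n; rewrite bE jE /=; case: ifPn => // on.
    by rewrite Jn //; apply: contraNneq oi => <- /=; rewrite on.
  - by move=> h x; rewrite jE /= rJ aE (negbTE oi) rdot0r.
have [j1 [j1E j1n j1b j1a]] := slot 0%N d1 isT.
have [j2 [j2E j2n j2b j2a]] := slot 2%N d2 isT.
exists (hsum (fun=> D)), a, b, j1, j2; split; [split|split|split|] => //.
- move=> x; apply: hsum_ext => n; rewrite !aE.
  by case: n => [|n] //=; case: (odd n).
- by move=> x; apply: hsum_ext => n; rewrite !bE /=; case: (odd n).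
- move=> x; apply: hsum_ext => n; rewrite coordD aE !bE aE /=.
  by case: n => [|n] /=; [rewrite add0r|case: (odd n) => /=; rewrite ?add0r ?addr0].
- move=> x y; apply: hsum_orth => n; rewrite aE bE; case: ifP; by rewrite ?rdot0l ?rdot0r.
- by move=> h; rewrite j1n d1E.
- by move=> h; rewrite j2n d2E.
- move=> h h'; apply: hsum_orth => n; rewrite j1E j2E.
  by case: eqP => [->|_]; rewrite ?rdot0l ?rdot0r.
Qed.

End Model.

(** * The lifting theorem *)

Section Main.
Variable R : realType.
Implicit Types H K : hilbertType R.

Lemma nsqZ1 H (q : R[i]) (x : H) : `|q| = 1 -> nsq (q *: x) = nsq x.
Proof. by move=> q1; apply/norm_eq_nsq; rewrite normrZ q1 mul1r. Qed.

Lemma bopD H K (A : 'B(H, K)) x y : A (x + y) = A x + A y.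
Proof. exact: linearD. Qed.

Lemma bopZ H K (A : 'B(H, K)) (c : R[i]) x : A (c *: x) = c *: A x.
Proof. exact: linearZ. Qed.

(** In the notation of the introduction [a] is alpha and [b] is beta.  The
    operators V_1 = G W_1 and V_2 = W_2 G^-1 are written down directly by
    multiplying the blocks of W_1 and W_2 by those of G = 1 + S + q S + ...  and
    of its inverse; this uses that S is its own inverse. *)
Lemma ando_isometry H (Q T1 T2 : 'B(H)) (q : R[i]) :
  contraction_op T1 -> contraction_op T2 -> T1 \o T2 =1 T2 \o Q \o T1 ->
  isometry_op Q -> `|q| = 1 ->
  exists (K : hilbertType R) (iota : 'B(H, K)) (Qbar V1 V2 : 'B(K)),
     isometry_op iota /\
     [/\ dsum_scalar iota Q q Qbar,
         is_isometric_lift iota Q Qbar,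
         is_isometric_lift iota T1 V1,
         is_isometric_lift iota T2 V2 &
         V1 \o V2 =1 V2 \o Qbar \o V1].
Proof.
move=> hT1 hT2 hT /isometry_nsq hQ q1.
have [F [a [b [j1 [j2 [[aa bb abba ab ba] [Tj1 bj1 j1a] [Tj2 bj2 j2a] j1j2]]]]]] :=
  ex_defect_slots hT1 hT2.
have q0 : q != 0 by rewrite -normr_eq0 q1 oner_eq0.
have qn n : `|q ^+ n| = 1 by rewrite normrX q1 expr1n.
have qVn n : `|q^-1 ^+ n| = 1 by rewrite normrX normfV q1 invr1 expr1n.
pose p : {linear H -> F} := (j1 \o T2) \+ (a \o j2).
pose r : {linear H -> F} := (j2 \o (Q \o T1)) \+ q \*: (a \o j1).
(* alpha is isometric on F0, the kernel of beta. *)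
have ra x y : b x = 0 -> rin (a x) (a y) = rin x y.
  move=> bx; have := ab (x + y); rewrite !linearD !sqnD bx rdot0l.
  have := ab x; have := ab y; rewrite bx sqn0; lra.
have j1Z h (c : R[i]) y : rin (j1 h) (c *: a y) = 0 by rewrite -linearZ j1a.
have TTQ h : T1 (T2 h) = T2 (Q (T1 h)) := hT h.
have [|h h'|S [SS Snsq Spr]] := @reflection _ H F p r.
- move=> h; rewrite /p /r /= !sqnD j1a -[q *: _]linearZ j2a linearZ nsqZ1 // !mulr0 !addr0.
  have := Tj1 (T2 h); have := Tj2 h; have := ab (j2 h); rewrite bj2 sqn0.
  have := Tj2 (Q (T1 h)); have := Tj1 h; have := ab (j1 h); rewrite bj1 sqn0.
  rewrite hQ TTQ; lra.
- rewrite /p /r /= !rdotDl !rdotDr j1j2 j1Z rdotC j2a -linearZ ra // -linearZ.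
  by rewrite rdotC j1j2; lra.
have SprE h : S (j1 (T2 h)) + S (a (j2 h)) = j2 (Q (T1 h)) + q *: a (j1 h).
  by rewrite -linearD; exact: Spr.
have SabS x : S (a (b (S x))) + S (b (a (S x))) = x by rewrite -linearD /= abba SS.
have qV1 n (v : F) : q ^+ n.+1 *: (q^-1 ^+ n *: v) = q *: v.
  by rewrite scalerA exprS exprVn mulfK // expf_neq0.
have qV2 n (v : F) : q^-1 ^+ n *: (q *: (q ^+ n *: v)) = q *: v.
  by rewrite !scalerA mulrCA exprVn mulVf ?mulr1 // expf_neq0.
have rS x y : rin (S x) (S y) = rin x y := polarization (p := S) (r := idfun) Snsq x y.
have [||||V1 [V1n V10 V11 V1S]] := @ex_bidiagonal _ H F T1 (S \o j1)
  (fun n => q ^+ n \*: (S \o a)) (fun n => q ^+ n.+1 \*: (S \o b)).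
- by move=> h; rewrite /= Snsq Tj1.
- by move=> n x; rewrite /= !nsqZ1 // !Snsq ab.
- by move=> h x; rewrite /= expr0 scale1r rS j1a.
- by move=> n x y; rewrite /= -!linearZ rS ba.
have [||||V2 [V2n V20 V21 V2S]] := @ex_bidiagonal _ H F T2 j2
  (fun n => q^-1 ^+ n \*: (a \o S)) (fun n => q^-1 ^+ n \*: (b \o S)).
- exact: Tj2.
- by move=> n x; rewrite /= !nsqZ1 // ab Snsq.
- by move=> h x; rewrite /= expr0 scale1r j2a.
- by move=> n x y; rewrite /= -!linearZ ba.
have [||||Qb [Qbn Qb0 Qb1 QbS]] := @ex_bidiagonal _ H F Q \0
  (fun n => q \*: idfun) (fun n => \0).
- by move=> h; rewrite /= sqn0 addr0 hQ.
- by move=> n x; rewrite /= nsqZ1 // sqn0 addr0.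
- by move=> h x; rewrite /= rdot0l.
- by move=> n x y; rewrite /= rdot0l.
have [P PE] := ex_coord (ext_fam H F) 0.
have [iota [i0 iS]] := ex_inj (ext_fam H F) 0.
have riota := rin_inj_coord i0 iS.
have iP : is_adjoint iota P by apply: adjoint_rin => x y; rewrite riota PE.
exists (hsum (ext_fam H F)), iota, Qb, V1, V2; split.
  by apply/isometry_nsq => h; rewrite /sqn riota i0.
split.
- move=> x y yo.
  have y0 : y 0%N = 0.
    by apply: rin_inj => h; rewrite rdot0r -riota /rdot yo.
  apply: hsum_ext => -[|[|n]].
  + by rewrite Qb0 !coordD coordZ !i0 y0 addr0 scaler0 addr0.
  + by rewrite Qb1 /= !iS // !add0r.
  + by rewrite QbS /= !iS // !add0r.
- split; last exact/isometry_nsq.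
  by apply: (lift_criterion iP) => y; rewrite !PE Qb0.
- split; last exact/isometry_nsq.
  by apply: (lift_criterion iP) => y; rewrite !PE V10.
- split; last exact/isometry_nsq.
  by apply: (lift_criterion iP) => y; rewrite !PE V20.
move=> x; apply: hsum_ext => -[|[|[|n]]] /=.
- by rewrite V10 !V20 Qb0 V10.
- rewrite V11 V20 !V21 Qb0 Qb1 V10 V11 /= !expr0 !scale1r add0r.
  rewrite !(bopD, bopZ) !SS !aa linear0 !addr0.
  exact: SprE.
- rewrite V1S V21 V2S V2S QbS Qb1 V11 V1S /= !add0r expr0 !scale1r.
  rewrite !(bopD, bopZ) !SS !(aa, bj1, bj2) !linear0 ?scaler0 ?addr0 ?add0r.
  by rewrite -scalerDr [X in _ *: X = _]addrC SabS qV2 expr1 -scalerDr addrC abba.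
- rewrite V1S !V2S !QbS !V1S /= !add0r.
  rewrite !(bopD, bopZ) !SS !(aa, bb) !linear0 ?scaler0 ?addr0 ?add0r.
  by rewrite !qV1 !qV2 -!scalerDr [in LHS]addrC SabS [X in _ = _ *: X]addrC abba.
Qed.

Lemma ex_comp_op H K (L : hilbertType R) (B : 'B(K, L)) (A : 'B(H, K)) :
  exists C : 'B(H, L), forall x, C x = B (A x).
Proof.
have [M M0 AM] := bounded_nsq A; have [N N0 BN] := bounded_nsq B.
have [||C CE] := @ex_bounded_op _ _ _ (B \o A) (N * M); last by exists C.
- exact: linearP.
- by move=> x; rewrite /= -mulrA (le_trans (BN _)) // ler_pM2l.
Qed.

Lemma is_lift_comp H K (L : hilbertType R) (i : 'B(H, K)) (j : 'B(K, L))
    (k : 'B(H, L)) (A : 'B(H)) (B : 'B(K)) (C : 'B(L)) :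
  (forall x, k x = j (i x)) -> is_lift i A B -> is_lift j B C -> is_lift k A C.
Proof.
move=> kE [A' [B1 [AA' BB1 iA]]] [B2 [C' [BB2 CC' jB]]].
exists A', C'; split=> // x.
by rewrite !kE jB (is_adjoint_uniq BB2 BB1) iA.
Qed.

(** Q' is the shift-type isometric lift of Q.  The operators [T (x 0)] on the sum
    ignore all but the first coordinate, and the first coordinate of Q' is Q, so
    the relation between T1, T2 and Q is inherited. *)
Lemma ex_isometric_lift H (Q T1 T2 : 'B(H)) :
  contraction_op Q -> contraction_op T1 -> contraction_op T2 ->
  T1 \o T2 =1 T2 \o Q \o T1 ->
  exists (K : hilbertType R) (iota : 'B(H, K)) (Q' S1 S2 : 'B(K)),
    [/\ isometry_op iota, isometry_op Q', contraction_op S1 & contraction_op S2] /\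
    [/\ is_lift iota Q Q', is_lift iota T1 S1, is_lift iota T2 S2 &
        S1 \o S2 =1 S2 \o Q' \o S1].
Proof.
move=> hQ /contraction_nsq hT1 /contraction_nsq hT2 hT.
have [d dE] := ex_defect hQ.
set D : hilbertType R := hsum (fun=> H) in d dE.
have [||||Q' [Q'n Q'0 _ _]] :=
    @ex_bidiagonal _ H D Q d (fun=> \0) (fun=> idfun).
- exact: dE.
- by move=> n x; rewrite /= sqn0 add0r.
- by move=> h x; rewrite /= rdot0r.
- by move=> n x y; rewrite /= rdot0r.
have [P PE] := ex_coord (ext_fam H D) 0.
have [iota [i0 iS]] := ex_inj (ext_fam H D) 0.
have riota := rin_inj_coord i0 iS.
have iP : is_adjoint iota P by apply: adjoint_rin => x y; rewrite riota PE.
have iota_nsq h : nsq (iota h) = nsq h by rewrite /sqn riota i0.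
have ext (T : 'B(H)) : (forall x, nsq (T x) <= nsq x) ->
    exists S : 'B(hsum (ext_fam H D)), contraction_op S /\
      (forall x, S x = iota (T (x 0%N))).
  move=> hTc; have [iT iTE] := ex_comp_op iota T; have [S SE] := ex_comp_op iT P.
  exists S; split; last by move=> x; rewrite SE iTE PE.
  apply/contraction_nsq => x; rewrite SE iTE iota_nsq PE.
  by apply: le_trans (hTc _) _; exact: (hsum_coord_le x 0).
have [S1 [S1c S1E]] := ext _ hT1; have [S2 [S2c S2E]] := ext _ hT2.
exists (hsum (ext_fam H D)), iota, Q', S1, S2; split; split => //.
- exact/isometry_nsq.
- exact/isometry_nsq.
- by apply: (lift_criterion iP) => y; rewrite !PE Q'0.
- by apply: (lift_criterion iP) => y; rewrite !PE S1E i0.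
- by apply: (lift_criterion iP) => y; rewrite !PE S2E i0.
- move=> x; rewrite /= S1E !S2E Q'0 S1E !i0; congr (iota _); exact: hT.
Qed.

End Main.

Theorem theorem5p10 (R : realType) (H : hilbertType R) (Q T1 T2 : 'B(H))
    (hQ : contraction_op Q) (hT1 : contraction_op T1) (hT2 : contraction_op T2)
    (hT : T1 \o T2 =1 T2 \o Q \o T1) :
  (exists (K : hilbertType R) (iota : 'B(H, K)) (Qbar V1 V2 : 'B(K)),
     isometry_op iota /\
     [/\ is_isometric_lift iota Q Qbar,
         is_isometric_lift iota T1 V1,
         is_isometric_lift iota T2 V2 &
         V1 \o V2 =1 V2 \o Qbar \o V1])
  /\
  (isometry_op Q ->
   forall q : R[i], `|q| = 1 ->
   exists (K : hilbertType R) (iota : 'B(H, K)) (Qbar V1 V2 : 'B(K)),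
     isometry_op iota /\
     [/\ dsum_scalar iota Q q Qbar,
         is_isometric_lift iota Q Qbar,
         is_isometric_lift iota T1 V1,
         is_isometric_lift iota T2 V2 &
         V1 \o V2 =1 V2 \o Qbar \o V1]).
Proof.
split; last by move=> Qiso q q1; exact: ando_isometry.
have [L [i [Q' [S1 [S2 [[ii Qi S1c S2c] [lQ l1 l2 SS]]]]]]] :=
  ex_isometric_lift hQ hT1 hT2 hT.
have [K [j [Qb [V1 [V2 [ji [_ [jQ Qbi] [j1 V1i] [j2 V2i] VV]]]]]]] :=
  ando_isometry S1c S2c SS Qi (normr1 R[i]).
have [k kE] := ex_comp_op j i.
exists K, k, Qb, V1, V2; split; first by move=> x; rewrite kE ji ii.
split=> //; split=> //.
- exact: is_lift_comp kE lQ jQ.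
- exact: is_lift_comp kE l1 j1.
- exact: is_lift_comp kE l2 j2.
Qed.
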